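(* Any Boolean-topological algebra quotient of a profinite algebra is again profinite. That is, if $X$ is a profinite algebra of type $\tau$, $Y$ is a Boolean-topological algebra of type $\tau$, and there is a surjective continuous homomorphism $X\twoheadrightarrow Y$, then $Y$ is profinite.
   Context: $\tau$ is an operational type (of finitary operations). A topological algebra of type $\tau$ is a topological space with an algebra structure of type $\tau$ whose basic operations are continuous. A Boolean-topological algebra is a topological algebra whose underlying space is compact Hausdorff with a basis of clopen sets. A topological algebra is profinite if it is (isomorphic to) the inverse limit, in the category of topological algebras of type $\tau$, of a directed inverse system of finite $\tau$-algebras (with discrete topology) and $\tau$-algebra morphisms. *)

(* Defs.v *)
From HB Require Import structures.
From mathcomp Require Import all_boot all_order.
From mathcomp Require Import all_classical topology.

Set Implicit Arguments.
Unset Strict Implicit.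
Unset Printing Implicit Defensive.

Local Open Scope classical_set_scope.

(* Arity 0 (constants) is allowed, and so are infinitely many symbols. *)
Record op_type := OpType {
  symbol : Type;
  arity : symbol -> nat }.

(* [{ptws 'I_n -> A}] is the n-th power of A with the product topology.
   A [topologicalType] is not assumed to be pointed: carriers may be empty. *)
Record top_algebra (tau : op_type) := TopAlgebra {
  carrier :> topologicalType;
  op : forall s : symbol tau, {ptws 'I_(arity s) -> carrier} -> carrier;
  op_continuous : forall s : symbol tau, continuous (op (s := s)) }.

Arguments op {tau} A s _ : rename.

Definition homomorphism (tau : op_type) (A B : top_algebra tau) (f : A -> B) :
    Prop :=
  forall (s : symbol tau) (x : 'I_(arity s) -> A),
    f (op A s x) = op B s (fun i => f (x i)).

(* Morphisms of the category of topological algebras of type tau. *)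
Definition morphism (tau : op_type) (A B : top_algebra tau) (f : A -> B) : Prop :=
  continuous f /\ homomorphism f.

Definition boolean_topological (tau : op_type) (A : top_algebra tau) : Prop :=
  [/\ compact [set: A], hausdorff_space A &
      exists B : set (set A), basis B /\ B `<=` clopen].

Definition finite_discrete (tau : op_type) (A : top_algebra tau) : Prop :=
  finite_set [set: A] /\ (forall U : set A, open U).

Definition directed (d : Order.disp_t) (I : porderType d) : Prop :=
  (exists i : I, True) /\
  (forall i j : I, exists k : I, (i <= k)%O /\ (j <= k)%O).

Record inverse_system (tau : op_type) (d : Order.disp_t) (I : porderType d) :=
    InverseSystem {
  obj :> I -> top_algebra tau;
  transition : forall i j : I, (i <= j)%O -> obj j -> obj i;
  transition_morphism : forall (i j : I) (ij : (i <= j)%O),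
    morphism (transition ij);
  transition_id : forall (i : I) (ii : (i <= i)%O) (x : obj i),
    transition ii x = x;
  transition_comp : forall (i j k : I)
    (ij : (i <= j)%O) (jk : (j <= k)%O) (ik : (i <= k)%O) (x : obj k),
    transition ij (transition jk x) = transition ik x }.

Arguments transition {tau d I} S {i j} ij _ : rename.

Definition cone (tau : op_type) (d : Order.disp_t) (I : porderType d)
    (S : inverse_system tau I) (L : top_algebra tau)
    (p : forall i : I, L -> S i) : Prop :=
  (forall i : I, morphism (p i)) /\
  (forall (i j : I) (ij : (i <= j)%O) (x : L),
    transition S ij (p j x) = p i x).

(* L, with projections p, is a limit of S in the category of topological
   algebras; limits being unique up to isomorphism, this says that L is
   isomorphic to the inverse limit of S. *)
Definition is_inverse_limit (tau : op_type) (d : Order.disp_t) (I : porderType d)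
    (S : inverse_system tau I) (L : top_algebra tau)
    (p : forall i : I, L -> S i) : Prop :=
  cone p /\
  (forall (Z : top_algebra tau) (q : forall i : I, Z -> S i), cone q ->
    exists! u : Z -> L,
      morphism u /\ (forall (i : I) (z : Z), p i (u z) = q i z)).

(* On finite discrete algebras every homomorphism is continuous, so the
   transition maps below are arbitrary algebra morphisms. *)
Definition profinite (tau : op_type) (A : top_algebra tau) : Prop :=
  exists (d : Order.disp_t) (I : porderType d) (S : inverse_system tau I)
         (p : forall i : I, A -> S i),
    [/\ directed I, (forall i : I, finite_discrete (S i)) &
        is_inverse_limit p].

(* Main.v *)
Require Import Defs.
From HB Require Import structures.
From mathcomp Require Import all_boot all_order.
From mathcomp Require Import all_classical topology.

(** Call a clopen set of a topological algebra recognizable if it is a union of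
    classes of an open congruence, that is, of a congruence all of whose classes
    are open.  On a compact algebra an open congruence has finitely many
    classes, so that it is the kernel of a continuous morphism onto a finite
    discrete algebra.  The theorem holds because recognizability of all clopen
    sets characterizes profiniteness among Boolean-topological algebras, and
    because it is inherited by quotients.

    In a profinite algebra [X] every clopen set is recognizable, and [X] is
    compact ([profinite_compact_recognizable]).  The universal property
    identifies [X] with a retract of the explicit limit of its inverse system,
    the algebra of compatible families; that algebra is compact, and since its
    basic open sets are given by one coordinate, a clopen set of it depends on
    a single coordinate.

    Let [f] map [X] onto [Y], and let [U] be clopen in [Y].  Then [f @^-1` U] is
    saturated by an open congruence [theta] of [X].  The join of [theta] with
    the kernel of [f] still saturates [f @^-1` U], because both congruences do,
    and it descends to a congruence of [Y] saturating [U].  The classes of the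
    latter are open because [f], going from a compact space to a Hausdorff one,
    is a topological quotient map ([push_congruence]).

    Conversely, if all clopen sets of a Boolean-topological algebra are
    recognizable, then that algebra is the limit of its quotients by open
    congruences ([recognizable_profinite]): compactness realizes every
    compatible family of classes by a point, and clopen sets, hence open
    congruences, separate points and determine the topology. *)

Set Implicit Arguments.
Unset Strict Implicit.
Unset Printing Implicit Defensive.

Local Open Scope classical_set_scope.

(** * Topological preliminaries *)

Lemma cvg_initial (T : choiceType) (U : topologicalType) (g : T -> U)
    (F : set_system T) (t : T) : Filter F ->
  F --> (t : initial_topology g) <-> g @ F --> g t.
Proof.
move=> FF; split=> [Ft B /(initial_continuous (f := g)) /Ft //|gFt A].
rewrite (@nbhsE (initial_topology g)) => -[_ [[B oB <-] Bgt]] sBA.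
by apply: filterS sBA _; apply: gFt; apply: open_nbhs_nbhs.
Qed.

(** Products and the space of compatible families both carry such a supremum
    of initial topologies, so this single criterion serves for the two. *)
Lemma cvg_initial_family (T : choiceType) (I : Type) (U : I -> topologicalType)
    (g : forall i, T -> U i) (F : set_system T) (t : T) : Filter F ->
  F --> (t : sup_topology
               (fun i => Topological.class (initial_topology (g i)))) <->
  forall i, g i @ F --> g i t.
Proof.
move=> FF; rewrite cvg_sup.
by split=> cF i; apply/cvg_initial; apply: cF.
Qed.

Lemma cvg_ptws (I : Type) (U : topologicalType) (F : set_system (I -> U))
    (x : I -> U) : Filter F ->
  F --> (x : {ptws I -> U}) <-> forall i, (fun y => y i) @ F --> x i.
Proof. exact: (@cvg_initial_family _ I (fun=> U) (fun i y => y i)). Qed.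

Lemma continuous_from_discrete (S T : topologicalType) (f : S -> T) :
  (forall U : set S, open U) -> continuous f.
Proof. by move=> dS; apply/continuousP. Qed.

Lemma nbhs_discrete (S : topologicalType) (x : S) :
  (forall U : set S, open U) -> nbhs x [set x].
Proof. by move=> dS; apply: open_nbhs_nbhs. Qed.

(** Arities being finite, every operation on a discrete algebra is
    continuous: a singleton of the power is cut out by finitely many
    coordinates. *)
Lemma ptws_discrete (I : finType) (S : topologicalType) :
  (forall U : set S, open U) -> forall U : set {ptws I -> S}, open U.
Proof.
move=> dS U; rewrite openE => x Ux.
have eval_x i : \forall y \near (x : {ptws I -> S}), y i = x i.
  exact: (@proj_continuous I (fun=> S) i x _ (nbhs_discrete (x i) dS)).
have := filter_forall (nbhs_filter x) eval_x.
by move/filterS; apply=> y yx; rewrite (_ : y = x)//; apply/funext.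
Qed.

(** On an infinite space the cofinite filter would be proper, but no point of
    a discrete space clusters it. *)
Lemma compact_discrete_finite (S : topologicalType) :
  (forall U : set S, open U) -> compact [set: S] -> finite_set [set: S].
Proof.
move=> dS cS; apply: contrapT => infS.
pose F : set_system S := [set B | finite_set (~` B)].
have PF : ProperFilter F.
  apply: Build_ProperFilter; first by rewrite /F /= setC0.
  split; first by rewrite /F /= setCT.
    by move=> A B; rewrite /F /= setCI finite_setU.
  by move=> A B sAB; apply: sub_finite_set; apply: subsetC.
have [p [_ /(_ (~` [set p]) [set p])]] := cS F PF (@filterT _ F _).
case; first by rewrite /F /= setCK.
  exact: nbhs_discrete.
by move=> q [/= qp /qp].
Qed.

Lemma surjective_compact (S T : topologicalType) (f : S -> T) :
  continuous f -> (forall y, exists x, f x = y) -> compact [set: S] ->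
  compact [set: T].
Proof.
move=> fc fs cS; rewrite (_ : setT = f @` setT).
  by apply: continuous_compact => //; apply: continuous_subspaceT.
by apply/seteqP; split=> // y _; have [x <-] := fs y; exists x.
Qed.

(** The map is closed, since compact sets have compact, hence closed, images;
    so the topology of the target is the quotient topology. *)
Lemma surjective_open (S T : topologicalType) (f : S -> T) (C : set T) :
  continuous f -> (forall y, exists x, f x = y) -> compact [set: S] ->
  hausdorff_space T -> open (f @^-1` C) -> open C.
Proof.
move=> fc fs cS hT oC; rewrite -[C]setCK openC.
rewrite (_ : ~` C = f @` (f @^-1` (~` C))).
  apply: compact_closed => //; apply: continuous_compact.
    exact: continuous_subspaceT.
  apply: subclosed_compact cS _ => //.
  by rewrite preimage_setC closedC.
apply/seteqP; split=> [y Cy|_ [x ? <-]//].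
by have [x xy] := fs y; exists x; rewrite //= xy.
Qed.

Lemma clopen_separation (T : topologicalType) (B : set (set T)) :
  hausdorff_space T -> basis B -> B `<=` clopen ->
  forall x y : T, (forall U, clopen U -> U x -> U y) -> x = y.
Proof.
move=> hT [_ bB] Bcl x y xy; apply: hT => A C Ax Cy.
have [U [BU Ux] sUA] := bB x A Ax.
exists y; split; last exact: nbhs_singleton.
by apply: sUA; apply: xy Ux; apply: Bcl.
Qed.

Section Directed.
Context {d : Order.disp_t} {I : porderType d} (dI : directed I).

(** The members of the family generate a proper filter, any cluster point of
    which lies in all of them. *)
Lemma compact_directed (T : topologicalType) (C : I -> set T) :
  compact [set: T] -> (forall i, closed (C i)) -> (forall i, C i !=set0) ->
  (forall i j, (i <= j)%O -> C j `<=` C i) -> exists x, forall i, C i x.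
Proof.
move=> cT clC C0 decC.
pose F := filter_from [set: I] C.
have FF : ProperFilter F.
  apply: filter_from_proper => //; apply: filter_from_filter.
    by have [[i _] _] := dI; exists i.
  move=> i j _ _; have [k [ik jk]] := dI.2 i j.
  by exists k => // x Ckx; split; [apply: decC ik _ _|apply: decC jk _ _].
have [x [_ clx]] := cT F FF (@filterT _ F _).
by exists x => i; apply: clC => B xB; apply: clx => //; exists i.
Qed.

Lemma tail_filter :
  ProperFilter (filter_from [set: I] (fun i => [set j | (i <= j)%O])).
Proof.
apply: filter_from_proper; last by move=> i _; exists i => /=.
apply: filter_from_filter; first by have [[i _] _] := dI; exists i.
move=> i j _ _; have [k [ik jk]] := dI.2 i j.
by exists k => // l /= kl; split; apply: Order.POrderTheory.le_trans kl.
Qed.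

End Directed.

(** * Open congruences *)

(** Openness of the classes says that the projection to the quotient, given
    the discrete topology, is continuous; in a compact algebra it also forces
    the quotient to be finite. *)
Record open_congruence (tau : op_type) (A : top_algebra tau) :=
    OpenCongruence {
  congr_rel :> rel A;
  congr_refl : reflexive congr_rel;
  congr_sym : symmetric congr_rel;
  congr_trans : transitive congr_rel;
  congr_op : forall (s : symbol tau) (x y : 'I_(arity s) -> A),
    (forall i, congr_rel (x i) (y i)) -> congr_rel (op A s x) (op A s y);
  congr_open : forall x, open [set y | congr_rel x y] }.

Definition saturates (T : Type) (r : rel T) (U : set T) : Prop :=
  forall x y, r x y -> U x -> U y.

(** As in the theory of recognizable languages: such a clopen set is the
    preimage of a subset of a discrete quotient, which is finite when the
    algebra is compact. *)
Definition recognizable_clopens (tau : op_type) (A : top_algebra tau) : Prop :=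
  forall U : set A, clopen U -> exists r : open_congruence A, saturates r U.

Lemma kernel_congruence (tau : op_type) (A B : top_algebra tau) (f : A -> B) :
  morphism f -> (forall U : set B, open U) ->
  exists r : open_congruence A, forall x y, r x y = (f x == f y).
Proof.
move=> [fc fh] dB; unshelve eexists (@OpenCongruence _ _ (fun x y => f x == f y)
  _ _ _ _ _).
- by move=> x /=; exact: eqxx.
- by move=> x y; rewrite eq_sym.
- by move=> y x z /eqP -> /eqP ->.
- move=> s x y xy /=; rewrite !fh; apply/eqP; congr (op B s _).
  by apply/funext => i; apply/eqP.
- move=> x; rewrite (_ : mkset _ = f @^-1` [set z | f x == z])//.
  by move/continuousP: fc; apply.
- by [].
Qed.

(** * Pushing open congruences forward *)

Section Pushforward.
Context {tau : op_type} {X Y : top_algebra tau} (f : X -> Y).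
Context (fhom : homomorphism f) (fsurj : forall y, exists x, f x = y).
Context (theta : open_congruence X).

Definition image_rel (y y' : Y) : Prop :=
  exists x x', [/\ theta x x', f x = y & f x' = y'].

(** The image of a congruence under a surjective morphism is reflexive,
    symmetric and compatible with the operations, but need not be transitive;
    chains of related elements repair this.  The length is explicit because
    the arguments of an operation are treated simultaneously, along chains of
    one common length. *)
Fixpoint chain (n : nat) (y y' : Y) : Prop :=
  if n is n'.+1 then exists2 w, image_rel y w & chain n' w y' else y = y'.

Lemma image_rel_refl y : image_rel y y.
Proof. by have [x <-] := fsurj y; exists x, x; rewrite congr_refl. Qed.

Lemma chain_cat m n y z w : chain m y z -> chain n z w -> chain (m + n) y w.
Proof.
elim: m y => [y <- //|m IHm y [v yv vz] zw].
by exists v => //; apply: IHm.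
Qed.

Lemma chain_sym n y z : chain n y z -> chain n z y.
Proof.
elim: n y => [y //|n IHn y [v [x [x' [xx' xy x'v]]] vz]].
rewrite -addn1; apply: chain_cat (IHn _ vz) _.
by exists y => //; exists x', x; rewrite congr_sym.
Qed.

(** Reflexivity allows a chain to be padded. *)
Lemma chain_weaken m n y z : (m <= n)%N -> chain m y z -> chain n y z.
Proof.
move=> mn myz; rewrite -(subnK mn); apply: chain_cat myz.
by elim: (n - m)%N => //= k IHk; exists y => //; exact: image_rel_refl.
Qed.

Lemma image_rel_op (s : symbol tau) (y z : 'I_(arity s) -> Y) :
  (forall i, image_rel (y i) (z i)) -> image_rel (op Y s y) (op Y s z).
Proof.
move=> yz; have /choice[x /choice[x' xx']] := yz.
exists (op X s x), (op X s x'); rewrite !fhom; split.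
- by apply: congr_op => i; have [] := xx' i.
- by congr (op Y s _); apply/funext => i; have [] := xx' i.
- by congr (op Y s _); apply/funext => i; have [] := xx' i.
Qed.

Lemma chain_op n (s : symbol tau) (y z : 'I_(arity s) -> Y) :
  (forall i, chain n (y i) (z i)) -> chain n (op Y s y) (op Y s z).
Proof.
elim: n y => [y yz|n IHn y yz] /=.
  by congr (op Y s _); apply/funext => i; exact: yz.
have /choice[w yw] : forall i, exists v, image_rel (y i) v /\ chain n v (z i).
  by move=> i; have [v] := yz i; exists v.
exists (op Y s w).
  by apply: image_rel_op => i; have [] := yw i.
by apply: IHn => i; have [] := yw i.
Qed.

Lemma chain_saturates n (U : set Y) y z :
  saturates theta (f @^-1` U) -> chain n y z -> U y -> U z.
Proof.
move=> satU; elim: n y => [y <- //|n IHn y [w [x [x' [xx' <- <-]]] wz] Ux].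
exact: IHn wz (satU _ _ xx' Ux).
Qed.

(** The relation of being joined by a chain is the image of the join of [theta]
    and the kernel of [f].  The preimages of its classes are unions of classes
    of [theta], hence open, and [surjective_open] applies. *)
Lemma push_congruence (U : set Y) :
  continuous f -> compact [set: X] -> hausdorff_space Y ->
  saturates theta (f @^-1` U) -> exists r : open_congruence Y, saturates r U.
Proof.
move=> fc cX hY satU.
pose r y z := `[< exists n, chain n y z >].
unshelve eexists (@OpenCongruence _ _ r _ _ _ _ _).
- by move=> y; apply/asboolP; exists 0%N.
- move=> y z; apply: asbool_equiv_eq.
  by split=> -[n yz]; exists n; apply: chain_sym.
- move=> z y w /asboolP[m yz] /asboolP[n zw]; apply/asboolP.
  by exists (m + n)%N; apply: chain_cat yz zw.
- move=> s y z yz; apply/asboolP.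
  have /choice[n nyz] i : exists n, chain n (y i) (z i) by apply/asboolP/yz.
  exists (\max_i n i)%N; apply: chain_op => i.
  by apply: chain_weaken (nyz i); apply: leq_bigmax.
- move=> y; apply: (surjective_open fc fsurj cX hY).
  rewrite openE => x /asboolP[n yx].
  have := open_nbhs_nbhs (conj (congr_open theta x) (congr_refl theta x)).
  apply: filterS => x' /= xx'; apply/asboolP; exists (n + 1)%N.
  by apply: chain_cat yx _; exists (f x') => //; exists x, x'.
- by move=> y z /asboolP[n]; apply: chain_saturates.
Qed.

End Pushforward.

(** * The algebra of compatible families *)

Section Threads.
Context {tau : op_type} {d : Order.disp_t} {I : porderType d}.
Context (S : inverse_system tau I).

Record threads := Thread {
  thread :> forall i, S i;
  thread_compatible : forall (i j : I) (ij : (i <= j)%O),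
    transition S ij (thread j) = thread i }.

Lemma thread_inj (x y : threads) : (forall i, x i = y i) -> x = y.
Proof.
case: x y => [x xc] [y yc] /= xy.
have exy : x = y by apply: functional_extensionality_dep.
by case: y / exy yc {xy} => yc; congr Thread; exact: Prop_irrelevance.
Qed.

HB.instance Definition _ := gen_eqMixin threads.
HB.instance Definition _ := gen_choiceMixin threads.
HB.instance Definition _ := Topological.copy threads
  (sup_topology (fun i => Topological.class
     (initial_topology (fun x : threads => x i)))).

Lemma cvg_threads (F : set_system threads) (x : threads) : Filter F ->
  F --> x <-> forall i, (fun y : threads => y i) @ F --> x i.
Proof.
exact: (@cvg_initial_family _ I (fun i => S i) (fun i (y : threads) => y i)).
Qed.

Lemma thread_continuous i : continuous (fun x : threads => x i).
Proof.
move=> x; have [+ _] := cvg_threads x (nbhs_filter x).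
by apply; apply: cvg_id.
Qed.

Definition thread_op (s : symbol tau) (x : {ptws 'I_(arity s) -> threads}) :
  threads.
Proof.
exists (fun i => op (S i) s (fun k => x k i)) => i j ij.
rewrite (transition_morphism S ij).2; congr (op (S i) s _).
by apply/funext => k; exact: thread_compatible.
Defined.

Lemma thread_op_continuous s : continuous (@thread_op s).
Proof.
move=> x; have fx := fmap_filter (@thread_op s) (nbhs_filter x).
apply/cvg_threads => i.
pose ev (y : {ptws 'I_(arity s) -> threads}) : {ptws 'I_(arity s) -> S i} :=
  fun k => y k i.
suff cev : {for x, continuous ev}.
  exact: (continuous_comp cev (@op_continuous _ (S i) s (ev x))).
have fev := fmap_filter ev (nbhs_filter x).
apply/cvg_ptws => k.
have cpr := @proj_continuous _ (fun=> threads) k x.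
exact: (continuous_comp cpr (@thread_continuous i (x k))).
Qed.

Definition thread_algebra := TopAlgebra thread_op_continuous.

End Threads.

Section ThreadsCompact.
Context {tau : op_type} {d : Order.disp_t} {I : porderType d}.
Context (S : inverse_system tau I).
Context (finS : forall i, finite_discrete (S i)).

(** Along an ultrafilter each coordinate, ranging over a finite set, is
    eventually constant; these constants form a compatible family, to which the
    ultrafilter converges. *)
Lemma threads_compact : compact [set: threads S].
Proof.
rewrite compact_ultra => F FU _.
have exs : forall i, exists a, F [set x : threads S | x i = a].
  move=> i; have [finSi dSi] := finS i.
  have PF : ProperFilter ((fun x : threads S => x i) @ F).
    exact: fmap_proper_filter.
  have [a [_ cla]] := finite_compact finSi PF filterT.
  exists a; have [//|Fna] := in_ultra_setVsetC [set x : threads S | x i = a] FU.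
  by have [b [/= nab /nab]] := cla (~` [set a]) _ Fna (nbhs_discrete a dSi).
have [s Fs] : exists s : forall i, S i,
    forall i, F [set x : threads S | x i = s i].
  by exists (fun i => projT1 (cid (exs i))) => i; exact: projT2 (cid (exs i)).
(* two members of the ultrafilter meet, and at a common point the coordinates
   are compatible *)
have compat i j (ij : (i <= j)%O) : transition S ij (s j) = s i.
  have [x [/= <- <-]] := filter_ex (filterI (Fs i) (Fs j)).
  exact: thread_compatible.
exists (Thread compat); split=> //.
apply/cvg_threads => i A /nbhs_singleton Asi.
have sA : [set x : threads S | x i = s i] `<=` (fun x => A (x i)).
  by move=> x /= ->.
exact: filterS sA (Fs i).
Qed.

(** Around each point, membership in [W] is decided by some coordinate, hence
    by all later ones; compactness makes the coordinate uniform. *)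
Lemma clopen_threads (W : set (threads S)) : directed I -> clopen W ->
  exists i, forall x y : threads S, x i = y i -> W x -> W y.
Proof.
move=> dI [oW cW].
have FI := tail_filter dI.
pose P i (x : threads S) := forall y : threads S, x i = y i -> W x -> W y.
have /compact_near_coveringP/(_ I _ P) cov := threads_compact.
suff: \forall i \near filter_from [set: I] (fun i => [set j | (i <= j)%O]),
  [set: threads S] `<=` P i.
  move=> [i _ /(_ i (Order.POrderTheory.lexx i)) Pi].
  by exists i => x y; apply: Pi.
apply: cov => x _.
(* by directedness, one coordinate already determines a basic neighbourhood *)
have coords A : nbhs x A -> exists i, forall y : threads S, y i = x i -> A y.
  move=> xA.
  pose G := filter_from [set: I] (fun i => [set y : threads S | y i = x i]).
  have coarser i j (y : threads S) : (i <= j)%O -> y j = x j -> y i = x i.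
    by move=> ij yx; rewrite -!(thread_compatible _ ij) yx.
  have FG : Filter G.
    apply: filter_from_filter; first by have [[i _] _] := dI; exists i.
    move=> i j _ _; have [k [ik jk]] := dI.2 i j.
    by exists k => // y yx; split; apply: coarser yx.
  suff /(_ A xA)[i _ iA] : G --> x by exists i.
  apply/cvg_threads => i B /nbhs_singleton Bxi.
  by exists i => // y /= ->.
have [i Wi] : exists i, forall y z : threads S,
    y i = x i -> z i = x i -> W y -> W z.
  have [Wx|nWx] := pselect (W x).
    have [i iW] := coords W (open_nbhs_nbhs (conj oW Wx)).
    by exists i => y z _ /iW.
  have oCW : open (~` W) by rewrite openC.
  have [i iW] := coords (~` W) (open_nbhs_nbhs (conj oCW nWx)).
  by exists i => y z /iW.
exists ([set y : threads S | y i = x i], [set j | (i <= j)%O]).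
  split; last by exists i.
  exact: (@thread_continuous _ _ _ S i x _ (nbhs_discrete (x i) (finS i).2)).
move=> [y j] /= [yx ij] z yz; apply: Wi => //.
by rewrite -yx -!(thread_compatible _ ij) yz.
Qed.

End ThreadsCompact.

(** Let [L] be the algebra of compatible families.  The universal property of
    [X] yields [u : L -> X], its projections yield [h : X -> L], and the
    uniqueness part gives [u \o h = id].  Compactness passes from [L] to its
    image [X]; a clopen [V] of [X] satisfies [V = h @^-1` (u @^-1` V)], and
    [u @^-1` V] depends on a single coordinate. *)
Lemma profinite_compact_recognizable (tau : op_type) (X : top_algebra tau) :
  profinite X -> compact [set: X] /\ recognizable_clopens X.
Proof.
move=> [d [I [S [p [dI finS [[pmor pcomp] plim]]]]]].
pose L := thread_algebra S.
have projcone : @cone _ _ _ S L (fun i (x : threads S) => x i).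
  split=> [i|i j ij x]; last exact: thread_compatible.
  by split; [exact: thread_continuous|].
have [u [[umor pu] _]] := plim L _ projcone.
pose h (x : X) : L := Thread (fun i j ij => pcomp i j ij x).
have hmor : morphism h.
  split=> [x|s x]; last by apply: thread_inj => i /=; exact: (pmor i).2.
  have fh := fmap_filter h (nbhs_filter x).
  by apply/cvg_threads => i; exact: (pmor i).1.
have uh x : u (h x) = x.
  have [v [_ vuniq]] := plim X p (conj pmor pcomp).
  transitivity (v x).
    rewrite (vuniq (fun x => u (h x)))//; split=> [|i z]; last by rewrite pu.
    split=> [z|s z]; last by rewrite hmor.2 umor.2.
    exact: (continuous_comp (hmor.1 z) (umor.1 (h z))).
  by rewrite (vuniq (fun x => x))//; split=> //; split=> [z|//]; exact: cvg_id.
split.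
  have usurj x : exists z, u z = x by exists (h x); exact: uh.
  exact: (surjective_compact umor.1 usurj (threads_compact finS)).
move=> V cV; have [] := @clopen_threads _ _ _ S finS (u @^-1` V) dI.
  exact: preimage_clopen umor.1.
move=> i Vi; have [r rE] := kernel_congruence (pmor i) (finS i).2.
exists r => x y; rewrite rE => /eqP pxy Vx.
by rewrite -[y]uh; apply: (Vi (h x)) => //=; rewrite uh.
Qed.

(** * The inverse system of quotients by open congruences *)

Section CongruenceOrder.
Context {tau : op_type} {A : top_algebra tau}.
Implicit Types r : open_congruence A.

Lemma congr_eq r r' : (forall x y, r x y = r' x y) -> r = r'.
Proof.
case: r r' => [r r1 r2 r3 r4 r5] [r' r'1 r'2 r'3 r'4 r'5] /= rr'.
have e : r = r' by apply/funext => x; apply/funext => y.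
case: r' / e r'1 r'2 r'3 r'4 r'5 {rr'} => *.
by congr OpenCongruence; exact: Prop_irrelevance.
Qed.

(** Finer congruences are larger, as their quotients stand further up in the
    inverse system. *)
Definition congr_le r r' : bool := `[< forall x y, r' x y -> r x y >].

Lemma congr_le_refl : reflexive congr_le.
Proof. by move=> r; apply/asboolP. Qed.

Lemma congr_le_anti : antisymmetric congr_le.
Proof.
move=> r r' /andP[/asboolP rr' /asboolP r'r]; apply: congr_eq => x y.
by apply/idP/idP; [exact: r'r|exact: rr'].
Qed.

Lemma congr_le_trans : transitive congr_le.
Proof.
move=> r2 r1 r3 /asboolP r12 /asboolP r23; apply/asboolP => x y xy.
by apply: r12; apply: r23.
Qed.

End CongruenceOrder.

HB.instance Definition _ (tau : op_type) (A : top_algebra tau) :=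
  gen_eqMixin (open_congruence A).
HB.instance Definition _ (tau : op_type) (A : top_algebra tau) :=
  gen_choiceMixin (open_congruence A).

Fact refinement_display : Order.disp_t. Proof. exact: Order.Disp tt tt. Qed.

HB.instance Definition _ (tau : op_type) (A : top_algebra tau) :=
  Order.Le_isPOrder.Build refinement_display (open_congruence A)
    congr_le_refl congr_le_anti congr_le_trans.

Lemma congr_leP (tau : op_type) (A : top_algebra tau)
  (r r' : open_congruence A) : (r <= r')%O -> forall x y, r' x y -> r x y.
Proof. by move/asboolP. Qed.

Lemma congr_directed (tau : op_type) (A : top_algebra tau) :
  directed (open_congruence A).
Proof.
split.
  unshelve eexists; first apply: (@OpenCongruence _ _ (fun _ _ => true)) => //.
  - move=> x; rewrite (_ : mkset _ = setT); first exact: openT.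
    by apply/seteqP.
  - by [].
move=> r r'.
unshelve eexists;
    first apply: (@OpenCongruence _ _ (fun x y => r x y && r' x y)).
- by move=> x; rewrite !congr_refl.
- by move=> x y; rewrite congr_sym (congr_sym r').
- move=> y x z /andP[xy xy'] /andP[yz yz'].
  by rewrite (congr_trans xy yz) (congr_trans xy' yz').
- move=> s x y xy; apply/andP.
  by split; apply: congr_op => i; have /andP[] := xy i.
- move=> x; rewrite (_ : mkset _ = [set y | r x y] `&` [set y | r' x y]).
    by apply: openI; exact: congr_open.
  by apply/seteqP; split=> y /= => [/andP|[-> ->]].
- by split; apply/asboolP => x y /= /andP[].
Qed.

Section QuotientAlgebra.
Context {tau : op_type} {A : top_algebra tau} (r : open_congruence A).
Local Open Scope quotient_scope.

Definition congr_equiv : equiv_rel A :=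
  EquivRel r (congr_refl r) (congr_sym r) (congr_trans (o := r)).

Definition quotient_space := quotient_topology {eq_quot congr_equiv}.

Definition class_of : A -> quotient_space := \pi_quotient_space.

Lemma class_eq x y : (class_of x = class_of y) <-> r x y.
Proof. by split=> [/eqquotP|xy]; [|apply/eqquotP]. Qed.

Lemma class_surj c : exists x, class_of x = c.
Proof. by exists (repr c); exact: reprK. Qed.

Lemma class_continuous : continuous class_of.
Proof. exact: pi_continuous. Qed.

Lemma quotient_discrete : forall U : set quotient_space, open U.
Proof.
move=> U; rewrite /open/= /quotient_open openE => x Ux.
have := open_nbhs_nbhs (conj (congr_open r x) (congr_refl r x)).
apply: filterS => y /= /class_eq xy.
by rewrite /preimage /= -[\pi y]/(class_of y) -xy.
Qed.

Definition quotient_op (s : symbol tau)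
    (c : {ptws 'I_(arity s) -> quotient_space}) : quotient_space :=
  class_of (op A s (fun i => repr (c i))).

Lemma quotient_op_continuous s : continuous (@quotient_op s).
Proof.
apply: continuous_from_discrete; apply: ptws_discrete.
exact: quotient_discrete.
Qed.

Definition quotient_algebra := TopAlgebra quotient_op_continuous.

Lemma class_morphism : @morphism _ A quotient_algebra class_of.
Proof.
split; first exact: class_continuous.
move=> s x; apply/class_eq; apply: congr_op => i.
by apply/class_eq; symmetry; exact: reprK.
Qed.

Lemma quotient_finite_discrete :
  compact [set: A] -> finite_discrete quotient_algebra.
Proof.
move=> cA; split; last exact: quotient_discrete.
apply: compact_discrete_finite; first exact: quotient_discrete.
exact: surjective_compact class_continuous class_surj cA.
Qed.

End QuotientAlgebra.

Section QuotientSystem.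
Context {tau : op_type} {A : top_algebra tau}.

Definition quotient_map (r r' : open_congruence A) (_ : (r <= r')%O)
  (c : quotient_algebra r') : quotient_algebra r := class_of r (repr c).

(** The definition through representatives yields the expected map on classes
    because [r'] is finer than [r]. *)
Lemma quotient_map_class r r' (rr' : (r <= r')%O) x :
  quotient_map rr' (class_of r' x) = class_of r x.
Proof.
apply/class_eq; apply: (congr_leP rr'); apply/class_eq.
exact: reprK.
Qed.

Lemma quotient_map_morphism r r' (rr' : (r <= r')%O) :
  morphism (quotient_map rr').
Proof.
split; first exact/continuous_from_discrete/quotient_discrete.
move=> s c; rewrite [LHS]quotient_map_class.
exact: (class_morphism r).2.
Qed.

Lemma quotient_map_id r (rr : (r <= r)%O) c : quotient_map rr c = c.
Proof. by have [x <-] := class_surj c; exact: quotient_map_class. Qed.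

Lemma quotient_map_comp (r1 r2 r3 : open_congruence A) (r12 : (r1 <= r2)%O)
    (r23 : (r2 <= r3)%O) (r13 : (r1 <= r3)%O) c :
  quotient_map r12 (quotient_map r23 c) = quotient_map r13 c.
Proof. by have [x <-] := class_surj c; rewrite !quotient_map_class. Qed.

Definition quotient_system : inverse_system tau (open_congruence A) :=
  InverseSystem quotient_map_morphism quotient_map_id quotient_map_comp.

End QuotientSystem.

(** A cone [q] sends each [z] to a class [q r z] for every open congruence [r].
    These classes are closed and shrink as [r] gets finer, so by compactness
    they have a common point, which is unique by separation.  It depends
    continuously on [z] because a clopen neighbourhood of it is saturated by
    some [r], and [q r] is locally constant. *)
Lemma recognizable_profinite (tau : op_type) (A : top_algebra tau) :
  boolean_topological A -> recognizable_clopens A -> profinite A.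
Proof.
move=> [cA hA [B [bB Bcl]]] rec.
have sep x y : (forall r : open_congruence A, r x y) -> x = y.
  move=> rxy; apply: (clopen_separation hA bB Bcl) => U /rec[r satU].
  exact: satU (rxy r).
exists refinement_display, (open_congruence A), quotient_system,
  (fun r => class_of r).
split; first exact: congr_directed.
  by move=> r; exact: quotient_finite_discrete.
split.
  split=> [r|r r' rr' x]; first exact: class_morphism.
  exact: quotient_map_class.
move=> Z q [qmor qcomp].
have lift z : exists x, forall r, class_of r x = q r z.
  apply: (compact_directed (congr_directed A)
    (C := fun r => [set x | class_of r x = q r z])) => //.
  - move=> r; rewrite (_ : mkset _ = class_of r @^-1` [set q r z])//.
    apply: (continuous_closedP _).1; first exact: class_continuous.
    by rewrite -openC; exact: quotient_discrete.
  - by move=> r; have [x] := class_surj (q r z); exists x.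
  - move=> r r' rr' x /= xq.
    rewrite -(qcomp _ _ rr') -xq -[RHS]/(quotient_map rr' _).
    by rewrite quotient_map_class.
have {lift}[u uq] := choice lift.
have congr_u r z z' : q r z = q r z' -> r (u z) (u z').
  by move=> qz; apply/class_eq; rewrite !uq.
exists u; split; last first.
  move=> v [_ vq]; apply/funext => z; apply: sep => r.
  by apply/class_eq; rewrite uq; symmetry; exact: vq.
split; last by move=> r z; exact: uq.
split.
  move=> z W /(bB.2 (u z))[U [BU Uuz] sUW].
  have [r satU] := rec U (Bcl U BU).
  have qrz := (qmor r).1 z _ (nbhs_discrete _ (quotient_discrete (r := r))).
  apply: (@filterS _ (nbhs z) _ _ _ _ qrz) => z' /= qz'.
  by apply: sUW; apply: satU Uuz; apply: congr_u.
move=> s z; apply: sep => r; apply/class_eq.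
rewrite uq (qmor r).2 (class_morphism r).2.
by congr (op (quotient_algebra r) s _); apply/funext => i; rewrite uq.
Qed.

Theorem theorem4p3 (tau : op_type) (X Y : top_algebra tau) (f : X -> Y)
  (Xprofinite : profinite X) (Yboolean : boolean_topological Y)
  (fcont : continuous f) (fhom : homomorphism f)
  (fsurj : forall y : Y, exists x : X, f x = y) :
  profinite Y.
Proof.
have [cX recX] := profinite_compact_recognizable Xprofinite.
have [_ hY _] := Yboolean.
apply: recognizable_profinite => // U clU.
have [theta satU] := recX _ (preimage_clopen clU fcont).
exact: push_congruence satU.
Qed.
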